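(* Let $q\in\mathbb{C}$ with $q\ne-1$, and let $a,b$ be operators on $\mathcal{H}$ which, together with their adjoints, leave a dense subspace $\mathcal{D}$ stable and satisfy $ab-qba=1$ (the identity) on $\mathcal{D}$. Let $\alpha,\beta$ be non-zero complex numbers and define on $\mathcal{D}$ $$x=\alpha(b+a),\qquad p=i\beta(b-a),\qquad H=\frac12\left(\left(\frac{p}{\beta}\right)^2+\left(\frac{x}{\alpha}\right)^2\right),\qquad N=ba.$$ Then, on $\mathcal{D}$, $$[x,p]=\frac{4i\alpha\beta}{q+1}\,1+\frac{i(q-1)}{\alpha\beta(q+1)}\left(\beta^2x^2+\alpha^2p^2\right),$$ $$H=(q+1)N+1,\qquad H^\dagger=(\overline q+1)N^\dagger+1.$$ Moreover, let $\Phi_0,\Psi_0\in\mathcal{D}$ be non-zero vectors with $a\Phi_0=0$ and $b^\dagger\Psi_0=0$, let $\{\alpha_n\}_{n\ge1}$, $\{\beta_n\}_{n\ge1}$ be complex sequences, and put $\Phi_n=\alpha_n\,b\,\Phi_{n-1}$, $\Psi_n=\beta_n\,a^\dagger\,\Psi_{n-1}$ for $n\ge1$. Then for all $n\ge0$ $$H\Phi_n=\hat E_n\Phi_n,\qquad H^\dagger\Psi_n=\overline{\hat E_n}\,\Psi_n,\qquad \hat E_n=(q+1)[n]_q+1=2[n]_q+q^n.$$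
   Context: $\mathcal{H}$ is a complex Hilbert space with scalar product $\langle\cdot,\cdot\rangle$. $\mathcal{D}$ is contained in the domains of $a,b,a^\dagger,b^\dagger$ and mapped into itself by them; in general $b\neq a^\dagger$. All operators are regarded as maps $\mathcal{D}\to\mathcal{D}$, and $H^\dagger$, $N^\dagger=a^\dagger b^\dagger$ denote the (restrictions to $\mathcal{D}$ of the) adjoints. $[X,Y]=XY-YX$; $1$ also denotes the identity operator. For $q\in\mathbb{C}$, $[0]_q=0$ and $[n]_q=1+q+\cdots+q^{n-1}$ for $n\ge1$; $q^0=1$. *)

(* Defs.v *)
From HB Require Import structures.
From mathcomp Require Export all_boot all_order all_algebra.
From mathcomp Require Export sesquilinear complex.
From mathcomp Require Export boolp classical_sets reals topology normedtype.

Set Implicit Arguments.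
Unset Strict Implicit.
Unset Printing Implicit Defensive.

Export Order.TTheory GRing.Theory Num.Theory.
Export numFieldNormedType.Exports.

Local Open Scope classical_set_scope.
Local Open Scope ring_scope.

(* A completeNormedModType over R[i] whose norm is induced by a scalar product
   is a Hilbert space.  Forms of type {dot V for conj} are positive definite,
   linear in the first argument and antilinear in the second. *)
Definition induces_norm (R : realType) (V : completeNormedModType R[i])
  (dot : {dot V for (@Num.conj R[i])}) : Prop := forall u, dot u u = `|u| ^+ 2.

Section Operators.
Context {K : numFieldType} {V : normedModType K}.

Definition is_subspace (D : set V) : Prop :=
  D 0 /\ forall (c : K) u v, D u -> D v -> D (c *: u + v).

(* A possibly unbounded, partially defined operator: the values of op_fun
   outside op_dom are meaningless.  Linearity is the predicate is_linear_op. *)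
Record operator := Operator { op_dom : set V; op_fun :> V -> V }.

Definition is_linear_op (T : operator) : Prop :=
  is_subspace (op_dom T) /\
  forall (c : K) u v, op_dom T u -> op_dom T v ->
    T (c *: u + v) = c *: T u + T v.

Definition id_op := Operator setT id.

Definition add_op (S T : operator) :=
  Operator (op_dom S `&` op_dom T) (fun u => S u + T u).

Definition scale_op (c : K) (T : operator) :=
  Operator (op_dom T) (fun u => c *: T u).

Definition sub_op (S T : operator) := add_op S (scale_op (-1) T).

Definition mul_op (S T : operator) :=
  Operator [set u | op_dom T u /\ op_dom S (T u)] (fun u => S (T u)).

Definition comm_op (S T : operator) := sub_op (mul_op S T) (mul_op T S).

Definition restr_op (D : set V) (T : operator) :=
  Operator (D `&` op_dom T) T.

Definition stable_under (D : set V) (T : operator) : Prop :=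
  forall u, D u -> op_dom T u /\ D (T u).

Definition eq_on (D : set V) (S T : operator) : Prop :=
  forall u, D u -> [/\ op_dom S u, op_dom T u & S u = T u].

Definition maps_to (T : operator) (u v : V) : Prop := op_dom T u /\ T u = v.

End Operators.
Arguments operator {K} V.

Declare Scope operator_scope.
Delimit Scope operator_scope with op.
Bind Scope operator_scope with operator.
Arguments eq_on {K V} D S%_op T%_op.
Arguments restr_op {K V} D T%_op.
Notation "1" := id_op : operator_scope.
Notation "S + T" := (add_op S T) : operator_scope.
Notation "S - T" := (sub_op S T) : operator_scope.
Notation "S * T" := (mul_op S T) : operator_scope.
Notation "c *: T" := (scale_op c%R T) : operator_scope.

Section Adjoint.
Context {R : realType} {V : completeNormedModType R[i]}.
Variable dot : {dot V for (@Num.conj R[i])}.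

(* v lies in the domain of the adjoint when some w satisfies
   <T u, v> = <u, w> for all u in the domain of T; this w is unique, hence the
   value of the adjoint at v, when T is densely defined. *)
Definition adjoint_values (T : operator V) (v : V) : set V :=
  [set w | forall u, op_dom T u -> dot (T u) v = dot u w].

Definition adjoint (T : operator V) : operator V :=
  Operator [set v | adjoint_values T v !=set0]
           (fun v => xget 0 (adjoint_values T v)).

End Adjoint.

Definition qnum (K : pzRingType) (q : K) (n : nat) : K := \sum_(i < n) q ^+ i.

(* Main.v *)
(* On [D] every product of two combinations of [b] and [a] is, by [ab = 1 + q ba],
   a combination of [bb], [ba], [1] and [aa], so the operator identities reduce to
   identities between four scalars.  By density of [D], taking adjoints turns
   [ab - q ba = 1] into [b^dagger a^dagger - conj q a^dagger b^dagger = 1]: the pair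
   [(b^dagger, a^dagger)] satisfies the same relation with [conj q], and the
   eigenvalues of [a^dagger b^dagger] come from the lemma that gives those of [ba]. *)
Require Import Defs.
From mathcomp Require Import ring.

Set Implicit Arguments.
Unset Strict Implicit.
Unset Printing Implicit Defensive.

Local Open Scope classical_set_scope.
Local Open Scope ring_scope.

(** * Linear operators and subspaces *)

Lemma linear_opD (K : numFieldType) (V : normedModType K) (T : operator V) u v :
  is_linear_op T -> op_dom T u -> op_dom T v -> T (u + v) = T u + T v.
Proof. by move=> [_ TL] Tu Tv; have := TL 1 u v Tu Tv; rewrite !scale1r. Qed.

Lemma linear_op0 (K : numFieldType) (V : normedModType K) (T : operator V) :
  is_linear_op T -> T 0 = 0.
Proof.
move=> [[T0 _] TL]; have := TL 1 0 0 T0 T0.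
by rewrite !scale1r addr0 => /(congr1 (fun w => w - T 0)); rewrite subrr addrK.
Qed.

Lemma linear_opZ (K : numFieldType) (V : normedModType K) (T : operator V) c u :
  is_linear_op T -> op_dom T u -> T (c *: u) = c *: T u.
Proof.
move=> Tlin Tu; have [[T0 _] TL] := Tlin.
by have := TL c u 0 Tu T0; rewrite !addr0 (linear_op0 Tlin) addr0.
Qed.

Lemma subspaceZ (K : numFieldType) (V : normedModType K) (D : set V) c u :
  is_subspace D -> D u -> D (c *: u).
Proof. by move=> [D0 DL] Du; rewrite -[_ *: _]addr0; exact: DL. Qed.

Lemma subspaceD (K : numFieldType) (V : normedModType K) (D : set V) u v :
  is_subspace D -> D u -> D v -> D (u + v).
Proof. by move=> [D0 DL] Du Dv; rewrite -[u]scale1r; exact: DL. Qed.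

(** * Adjoints of densely defined operators *)

(** If [z = v - w] were non-zero, density would give a [u] in [D] closer to [z] than the length of
    [z]; but [u] is orthogonal to [z], so [z - u] is at least as long as [z]. *)
Lemma dense_dot_inj (R : realType) (V : completeNormedModType R[i])
    (dot : {dot V for (@Num.conj R[i])}) (D : set V) v w :
  induces_norm dot -> dense D ->
  (forall u, D u -> dot u v = dot u w) -> v = w.
Proof.
move=> dotN Dd uvw; apply/eqP; rewrite -subr_eq0; apply/negPn/negP => z0.
set z := v - w in z0.
have nz : 0 < `|z| by rewrite normr_gt0.
have [u [zu Du]] : (ball z `|z| `&` D) !=set0.
  by apply: Dd; [exists z; exact: ballxx | exact: ball_open].
have uz : dot u z = 0 by rewrite linearBr /= uvw // subrr.
have zu0 : dot z u = 0 by apply/eqP; rewrite herm_eq0C; apply/eqP.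
move: zu; rewrite -ball_normE /= => zu; clearbody z.
have : `|z - u| ^+ 2 < `|z| ^+ 2 by rewrite ltr_pXn2r ?nnegrE ?normr_ge0.
(* Pythagoras: u is orthogonal to z *)
rewrite -!dotN linearBl !linearBr /= uz zu0 subr0 sub0r opprK.
by rewrite (dotN u) gtrDl => /lt_geF; rewrite exprn_ge0.
Qed.

Lemma adjoint_dot (R : realType) (V : completeNormedModType R[i])
    (dot : {dot V for (@Num.conj R[i])}) (T : operator V) u v :
  op_dom T u -> op_dom (adjoint dot T) v ->
  dot (T u) v = dot u (adjoint dot T v).
Proof.
move=> Tu [w wv]; rewrite /adjoint /=.
exact: (@xgetPex _ 0 _ (ex_intro _ w wv)).
Qed.

(** Density makes adjoint values unique, so one candidate [w] settles both membership in the domain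
    and the value there. *)
Lemma adjoint_eq (R : realType) (V : completeNormedModType R[i])
    (dot : {dot V for (@Num.conj R[i])}) (D : set V) (T : operator V) v w :
  induces_norm dot -> dense D -> D `<=` op_dom T -> adjoint_values dot T v w ->
  maps_to (adjoint dot T) v w.
Proof.
move=> dotN Dd DT vw; have dv : op_dom (adjoint dot T) v by exists w.
split=> //; apply: (dense_dot_inj dotN Dd) => u /DT Tu.
by rewrite -adjoint_dot // vw.
Qed.

(** A combination of adjoint values is an adjoint value at the same combination of vectors;
    [adjoint_eq] then yields closure of the domain and linearity together. *)
Lemma adjoint_linear (R : realType) (V : completeNormedModType R[i])
    (dot : {dot V for (@Num.conj R[i])}) (D : set V) (T : operator V) :
  induces_norm dot -> dense D -> D `<=` op_dom T ->
  is_linear_op (adjoint dot T).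
Proof.
move=> dotN Dd DT.
have values c u v : op_dom (adjoint dot T) u -> op_dom (adjoint dot T) v ->
    adjoint_values dot T (c *: u + v) (c *: adjoint dot T u + adjoint dot T v).
  move=> Tu Tv w Tw.
  by rewrite !linearDr /= !linearZr_LR /= !(adjoint_dot Tw).
have maps c u v Tu Tv := adjoint_eq dotN Dd DT (values c u v Tu Tv).
split=> [|c u v Tu Tv]; last by case: (maps c u v Tu Tv).
split=> [|c u v Tu Tv]; last by case: (maps c u v Tu Tv).
by exists 0 => u _; rewrite !linear0r.
Qed.

(** Used with [e0], ..., [e3] equal to [b (b u)], [b (a u)], [u], [a (a u)], to add two expansions
    coefficient by coefficient. *)
Lemma scale_sum4D (K : numFieldType) (V : lmodType K) (c0 c1 c2 c3 d0 d1 d2 d3 : K)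
    (e0 e1 e2 e3 : V) :
  (c0 *: e0 + c1 *: e1 + c2 *: e2 + c3 *: e3)
  + (d0 *: e0 + d1 *: e1 + d2 *: e2 + d3 *: e3)
  = (c0 + d0) *: e0 + (c1 + d1) *: e1 + (c2 + d2) *: e2 + (c3 + d3) *: e3.
Proof.
by rewrite !scalerDl [LHS](AC ((1*1*1*1)*(1*1*1*1)) ((1*5)*(2*6)*(3*7)*(4*8))).
Qed.

Lemma qnumSl (K : pzRingType) (q : K) n : qnum q n.+1 = 1 + q * qnum q n.
Proof.
rewrite /qnum big_ord_recl expr0 mulr_sumr; congr (_ + _).
by apply: eq_bigr => i _; rewrite exprS.
Qed.

(** * Stability of a subspace under sums, multiples and products *)

Lemma stable_id (K : numFieldType) (V : normedModType K) (D : set V) :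
  stable_under D (@id_op K V).
Proof. by []. Qed.

Lemma stable_add (K : numFieldType) (V : normedModType K) (D : set V)
    (S T : operator V) :
  is_subspace D -> stable_under D S -> stable_under D T ->
  stable_under D (S + T)%op.
Proof.
move=> Ds DS DT u Du; have [Su DSu] := DS u Du; have [Tu DTu] := DT u Du.
by split; [| exact: subspaceD].
Qed.

Lemma stable_scale (K : numFieldType) (V : normedModType K) (D : set V) c
    (T : operator V) :
  is_subspace D -> stable_under D T -> stable_under D (c *: T)%op.
Proof.
by move=> Ds DT u Du; have [Tu DTu] := DT u Du; split; [| exact: subspaceZ].
Qed.

Lemma stable_mul (K : numFieldType) (V : normedModType K) (D : set V)
    (S T : operator V) :
  stable_under D S -> stable_under D T -> stable_under D (S * T)%op.
Proof.
by move=> DS DT u /DT[Tu DTu]; have [STu DSTu] := DS _ DTu.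
Qed.

Lemma stable_restr (K : numFieldType) (V : normedModType K) (D : set V)
    (T : operator V) : stable_under D T -> stable_under D (restr_op D T).
Proof. by move=> DT u Du; have [Tu DTu] := DT u Du. Qed.

(** Stability supplies the domain clauses of [eq_on], so only the values remain to be compared. *)
Lemma stable_eq_on (K : numFieldType) (V : normedModType K) (D : set V)
    (S T : operator V) :
  stable_under D S -> stable_under D T -> (forall u, D u -> S u = T u) ->
  eq_on D S T.
Proof.
by move=> DS DT ST u Du; split; [case: (DS u Du) | case: (DT u Du) | exact: ST].
Qed.

(** * The q-deformed commutation relation on [D] and its adjoint *)

Section Ladder.
Context (R : realType) (V : completeNormedModType R[i]).
Context (dot : {dot V for (@Num.conj R[i])}) (dot_norm : induces_norm dot).
Context (q : R[i]) (D : set V) (D_subspace : is_subspace D) (D_dense : dense D).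
Context (a b : operator V).
Context (a_linear : is_linear_op a) (b_linear : is_linear_op b).
Context (D_a : stable_under D a) (D_b : stable_under D b).
Context (D_adag : stable_under D (adjoint dot a)).
Context (D_bdag : stable_under D (adjoint dot b)).
Context (ab_qba : eq_on D (a * b - q *: (b * a)) 1).

Local Notation adag := (adjoint dot a).
Local Notation bdag := (adjoint dot b).

Lemma ladder_abE u : D u -> a (b u) = u + q *: b (a u).
Proof.
by move=> /ab_qba[_ _ /= /eqP]; rewrite scaleN1r subr_eq => /eqP.
Qed.

(** Position, momentum and their rescalings all have the form [s *: (b + t *: a)], so this one
    expansion serves every product of two of them. Only [a (b u)] has to be reordered; it yields the
    multiple of [u] and the summand [q * t]. *)
Lemma ladder_prodE u s t s' t' : D u ->
  let w := s' *: (b u + t' *: a u) in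
  s *: (b w + t *: a w)
  = (s * s') *: b (b u) + (s * s' * (t' + q * t)) *: b (a u)
    + (s * s' * t) *: u + (s * s' * t * t') *: a (a u).
Proof.
move=> Du w; have Dbu := (D_b Du).2; have Dau := (D_a Du).2.
have Dt : D (t' *: a u) by exact: subspaceZ.
have Dw : D (b u + t' *: a u) by exact: subspaceD.
have da v : D v -> op_dom a v by move=> /D_a[].
have db v : D v -> op_dom b v by move=> /D_b[].
rewrite /w !linear_opZ ?linear_opD ?linear_opZ; auto.
rewrite ladder_abE // !(scalerDr, scalerA) !addrA.
(* Of the five terms, the second and the fourth are multiples of [b (a u)]. *)
rewrite [LHS](AC 5 (1*(2*4)*3*5)) /= -scalerDl.
by congr (_ *: _ + _ *: _ + _ *: _ + _ *: _); ring.
Qed.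

(** Stated through [dot] because it serves both to find the adjoints of [N] and [H] and to conjugate
    the commutation relation. *)
Lemma ladder_adag_bdag v : D v ->
  forall u, D u -> dot (b (a u)) v = dot u (adag (bdag v)).
Proof.
move=> Dv u Du; have [bv Dbv] := D_bdag Dv; have [abv Dabv] := D_adag Dbv.
have [au Dau] := D_a Du; have [bau Dbau] := D_b Dau.
by rewrite adjoint_dot // adjoint_dot.
Qed.

(** Pairing with [u] in [D] turns the left side into [dot (a (b u)) v], where the relation between
    [a] and [b] applies; [q] passes to the second argument as its conjugate. *)
Lemma ladder_bdag_adagE v : D v -> bdag (adag v) = v + q^* *: adag (bdag v).
Proof.
move=> Dv; apply: (dense_dot_inj dot_norm D_dense) => u Du.
have [bv Dbv] := D_adag Dv; have [abv Dabv] := D_bdag Dbv.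
have [bu Dbu] := D_b Du; have [abu Dabu] := D_a Dbu.
rewrite -adjoint_dot // -adjoint_dot // ladder_abE //.
by rewrite linearDl linearDr /= linearZl_LR linearZr_LR /= conjCK ladder_adag_bdag.
Qed.

(** Induction on [n]: if [b a] multiplies [Phi n] by [c], then [b a b = b + q b b a] shows that it
    multiplies [b (Phi n)] by [1 + q * c], which is the recursion [qnumSl]. Membership in [D] is
    carried along because the relation is given on [D] only. *)
Lemma ladder_numberE Phi alpha_ : D (Phi 0%N) -> a (Phi 0%N) = 0 ->
  (forall n, Phi n.+1 = alpha_ n.+1 *: b (Phi n)) ->
  forall n, D (Phi n) /\ b (a (Phi n)) = qnum q n *: Phi n.
Proof.
move=> D0 a0 PhiS; elim=> [|n [Dn IH]].
  by rewrite a0 (linear_op0 b_linear) /qnum big_ord0 scale0r.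
have [bn Dbn] := D_b Dn; have [an Dan] := D_a Dn; have [ban Dban] := D_b Dan.
have [abn Dabn] := D_a Dbn; have [babn _] := D_b Dabn.
split; first by rewrite PhiS; exact: subspaceZ.
rewrite PhiS linear_opZ // linear_opZ // ladder_abE // IH.
have qn : D (q *: (qnum q n *: Phi n)) by apply: subspaceZ => //; exact: subspaceZ.
rewrite scalerA -{1}[Phi n]scale1r -scalerDl -qnumSl linear_opZ //.
by rewrite !scalerA mulrC.
Qed.

End Ladder.

Theorem mainTheorem8 (R : realType) (V : completeNormedModType R[i])
    (dot : {dot V for (@Num.conj R[i])}) (dot_norm : induces_norm dot)
    (q : R[i]) (q_neqN1 : q != -1)
    (D : set V) (D_subspace : is_subspace D) (D_dense : dense D)
    (a b : operator V) (a_linear : is_linear_op a) (b_linear : is_linear_op b)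
    (D_a : stable_under D a) (D_b : stable_under D b)
    (D_adag : stable_under D (adjoint dot a))
    (D_bdag : stable_under D (adjoint dot b))
    (ab_qba : eq_on D (a * b - q *: (b * a)) 1)
    (alpha beta : R[i]) (alpha_neq0 : alpha != 0) (beta_neq0 : beta != 0) :
  let adag := adjoint dot a in
  let bdag := adjoint dot b in
  let x := restr_op D (alpha *: (b + a)) in
  let p := restr_op D (('i * beta) *: (b - a)) in
  let X := (alpha^-1 *: x)%op in
  let P := (beta^-1 *: p)%op in
  let H := restr_op D (2^-1 *: (P * P + X * X)) in
  let N := restr_op D (b * a) in
  let Hdag := restr_op D (adjoint dot H) in
  let Ndag := restr_op D (adjoint dot N) in
  let E := fun n : nat => (q + 1) * qnum q n + 1 in
  [/\ eq_on D (comm_op x p)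
        ((4 * 'i * alpha * beta / (q + 1)) *: 1
         + ('i * (q - 1) / (alpha * beta * (q + 1)))
           *: ((beta ^+ 2) *: (x * x) + (alpha ^+ 2) *: (p * p))),
      eq_on D H ((q + 1) *: N + 1),
      eq_on D Ndag (adag * bdag),
      eq_on D Hdag ((q^* + 1) *: Ndag + 1)
    & forall (Phi Psi : nat -> V) (alpha_ beta_ : nat -> R[i]),
        D (Phi 0%N) -> D (Psi 0%N) -> Phi 0%N != 0 -> Psi 0%N != 0 ->
        a (Phi 0%N) = 0 -> bdag (Psi 0%N) = 0 ->
        (forall n, Phi n.+1 = alpha_ n.+1 *: b (Phi n)) ->
        (forall n, Psi n.+1 = beta_ n.+1 *: adag (Psi n)) ->
        forall n,
          [/\ maps_to H (Phi n) (E n *: Phi n),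
              maps_to Hdag (Psi n) ((E n)^* *: Psi n)
            & E n = 2 * qnum q n + q ^+ n]].
Proof.
move=> adag bdag x p X P H N Hdag Ndag E.
have q1 : q + 1 != 0 by rewrite addr_eq0.
have Dx : stable_under D x.
  by apply: stable_restr; apply: stable_scale => //; exact: stable_add.
have Dp : stable_under D p.
  apply: stable_restr; apply: stable_scale => //; apply: stable_add => //.
  exact: stable_scale.
have DH : stable_under D H.
  apply: stable_restr; apply: stable_scale => //.
  by apply: stable_add => //; apply: stable_mul; exact: stable_scale.
have DN : stable_under D N by apply: stable_restr; exact: stable_mul.
(* The four operators are put in the shape of [ladder_prodE], with [t = 1] for positions and
   [t = -1] for momenta. *)
have xE v : x v = alpha *: (b v + 1 *: a v) by rewrite /= scale1r.
have pE v : p v = ('i * beta) *: (b v + -1 *: a v) by [].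
have XE v : X v = 1 *: (b v + 1 *: a v).
  by rewrite -[X v]/(alpha^-1 *: x v) xE scalerA mulVf.
have PE v : P v = 'i *: (b v + -1 *: a v).
  by rewrite -[P v]/(beta^-1 *: p v) pE scalerA mulrC mulfK.
have ii : 'i * 'i = -1 :> R[i] by rewrite -expr2 sqrCi.
have prodE := ladder_prodE D_subspace a_linear b_linear D_a D_b ab_qba.
have HE u : D u -> H u = (q + 1) *: b (a u) + u.
  move=> Du; rewrite -[H u]/(2^-1 *: (P (P u) + X (X u))) !XE !PE !prodE //.
  rewrite scale_sum4D !scalerDr !scalerA ii.
  (* Since ['i * 'i = -1], the [b b] and [a a] terms of [P P] and [X X] cancel, while their [b a]
     and identity terms agree and the factor [2^-1] undoes the doubling. *)
  transitivity (0 *: b (b u) + (q + 1) *: b (a u) + 1 *: u + 0 *: a (a u)).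
    by congr (_ *: _ + _ *: _ + _ *: _ + _ *: _); field.
  by rewrite !scale0r scale1r add0r addr0.
(* The domain of [N] lies in [D], so the adjoint condition is tested on vectors of [D] only; the
   same holds for [H] below. *)
have NdagE v : D v -> maps_to (adjoint dot N) v (adag (bdag v)).
  move=> Dv; apply: (adjoint_eq dot_norm D_dense) => [u /DN[]//|u [Du _] /=].
  exact: (ladder_adag_bdag D_a D_b D_adag D_bdag).
have HdagE v : D v -> maps_to (adjoint dot H) v ((q^* + 1) *: adag (bdag v) + v).
  move=> Dv; apply: (adjoint_eq dot_norm D_dense) => [u /DH[]//|u [Du _]].
  rewrite HE // linearDl linearDr linearZl_LR linearZr_LR.
  congr (_ * _ + _); first by rewrite /= rmorphD rmorph1 /= conjCK.
  exact: (ladder_adag_bdag D_a D_b D_adag D_bdag).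
have DNdag : stable_under D Ndag.
  apply: stable_restr => v Dv; have [Nv Nv'] := NdagE v Dv.
  by split=> //; rewrite Nv'; case: (D_bdag v Dv) => _ /D_adag[].
have DHdag : stable_under D Hdag.
  apply: stable_restr => v Dv; have [Hv Hv'] := HdagE v Dv.
  split=> //; rewrite Hv'; apply: subspaceD => //; apply: subspaceZ => //.
  by case: (D_bdag v Dv) => _ /D_adag[].
split.
- apply: stable_eq_on.
  + apply: stable_add => //; first exact: stable_mul.
    by apply: stable_scale => //; exact: stable_mul.
  + apply: stable_add => //; first exact: stable_scale.
    apply: stable_scale => //.
    by apply: stable_add => //; apply: stable_scale => //; exact: stable_mul.
  move=> u Du.
  have -> : comm_op x p u = x (p u) + -1 *: p (x u) by [].
  (* The coefficients are generalised so that the operators unfold while the scalars stay opaque. *)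
  have -> : forall k l m n, (k *: 1 + l *: (m *: (x * x) + n *: (p * p)))%op u
    = k *: u + l *: (m *: x (x u) + n *: p (p u)) by [].
  rewrite !xE !pE !prodE // !scalerDr !scalerA !scale_sum4D.
  (* The multiple of [u] coming from the operator [1] joins the third coefficient. *)
  rewrite [RHS](AC (1*4) (2*3*(1*4)*5)) /= -scalerDl.
  (* With the square of ['i] removed, both sides are linear in ['i], and [field] can treat it as an
     indeterminate. *)
  have -> : 'i * beta * ('i * beta) = - (beta * beta).
    by rewrite mulrACA ii mulN1r.
  by congr (_ *: _ + _ *: _ + _ *: _ + _ *: _); field; rewrite q1 beta_neq0.
- apply: stable_eq_on => //.
  by apply: stable_add => //; exact: stable_scale.
- apply: stable_eq_on => // [|u Du]; first exact: stable_mul.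
  by have [_] := NdagE u Du.
- apply: stable_eq_on => // [|u Du].
    by apply: stable_add => //; exact: stable_scale.
  have [_ /= ->] := HdagE u Du; have [_ /= ->] := NdagE u Du.
  by [].
move=> Phi Psi alpha_ beta_ DPhi DPsi _ _ aPhi bPsi PhiS PsiS n.
have [Dn Nn] := ladder_numberE D_subspace a_linear b_linear D_a D_b ab_qba
  DPhi aPhi PhiS n.
have Da : D `<=` op_dom a by move=> u /D_a[].
have Db : D `<=` op_dom b by move=> u /D_b[].
have dag_ba : eq_on D (bdag * adag - q^* *: (adag * bdag)) 1.
  apply: stable_eq_on => // [|u Du].
    apply: stable_add => //; first exact: stable_mul.
    apply: stable_scale => //; apply: stable_scale => //; exact: stable_mul.
  rewrite -[LHS]/(bdag (adag u) + -1 *: (q^* *: adag (bdag u))).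
  rewrite (ladder_bdag_adagE dot_norm D_dense D_a D_b D_adag D_bdag ab_qba) //.
  by rewrite scaleN1r addrK.
(* Here [bdag] lowers, [adag] raises, and [q^*] replaces [q]. *)
have [Dm Nm] := ladder_numberE D_subspace (adjoint_linear dot_norm D_dense Db)
  (adjoint_linear dot_norm D_dense Da) D_bdag D_adag dag_ba DPsi bPsi PsiS n.
split.
- by split; [case: (DH _ Dn) | rewrite HE // Nn scalerA -{2}[Phi n]scale1r -scalerDl].
- split; first by case: (DHdag _ Dm).
  have [_ HPsi] := HdagE _ Dm; rewrite -[LHS]/(adjoint dot H (Psi n)) HPsi Nm.
  rewrite scalerA -{2}[Psi n]scale1r -scalerDl.
  (* Conjugation is a ring morphism, so it sends [qnum q n] to [qnum q^* n]. *)
  congr (_ *: _); rewrite /E !(rmorphD, rmorphM, rmorph1) /=.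
  by rewrite /qnum rmorph_sum; congr (_ * _ + _); apply: eq_bigr => i _; rewrite rmorphXn.
(* Writing [q + 1] as [2 + (q - 1)] brings in the telescoping geometric sum; nothing is divided by
   [q - 1], so [q = 1] is covered. *)
have qX : (q - 1) * qnum q n = q ^+ n - 1 by rewrite subrX1.
by rewrite -[q ^+ n](subrK 1) -qX /E; ring.
Qed.
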